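(* Let $X$ be a Banach space and let $A,B,C,D\in \mathcal{L}(X)$ be such that $$(AC)^2=(DB)(AC),\quad (DB)^2=(AC)(DB),\quad B(AC)A=B(DB)A,\quad C(AC)D=C(DB)D.$$ Then $$\sigma_d(BD)=\sigma_d(AC).$$
   Context: $X$ is a complex Banach space and $\mathcal{L}(X)$ is the Banach algebra of all bounded linear operators from $X$ to itself, with identity $I$. For a unital complex Banach algebra $\mathcal{A}$ and $a\in\mathcal{A}$, $comm(a)=\{x\in \mathcal{A} : xa=ax\}$, $comm^2(a)=\{x\in \mathcal{A} : xy=yx \text{ for all } y\in comm(a)\}$, and $\mathcal{A}^{qnil}=\{a\in \mathcal{A} : 1+ax\in \mathcal{A}^{-1}\text{ for every }x\in comm(a)\}$ (the elements with $\lim_{n\to\infty}\|a^n\|^{1/n}=0$). An element $a$ is g-Drazin invertible, written $a\in\mathcal{A}^d$, if there exists $b\in \mathcal{A}$ with $b=bab$, $b\in comm^2(a)$ and $a-a^2b\in \mathcal{A}^{qnil}$. For $T\in\mathcal{L}(X)$ the g-Drazin spectrum is $\sigma_{d}(T)=\{\lambda\in\mathbb{C} : \lambda I-T\notin \mathcal{L}(X)^{d}\}$. *)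

(* Defs.v *)
From HB Require Import structures.
From mathcomp Require Import all_boot all_order all_algebra.
From mathcomp Require Import complex.
From mathcomp Require Import boolp classical_sets functions reals normedtype.

Set Implicit Arguments.
Unset Strict Implicit.
Unset Printing Implicit Defensive.

Import Order.TTheory GRing.Theory Num.Theory.

Local Open Scope classical_set_scope.
Local Open Scope ring_scope.

Section BoundedOperators.
Variables (K : numFieldType) (X : normedModType K).

Definition is_bounded_operator (f : X -> X) : Prop :=
  linear f /\ exists M : K, forall x : X, `|f x| <= M * `|x|.

Definition bounded_operator_pred : {pred X -> X} :=
  fun f => `[< is_bounded_operator f >].

(* The Banach algebra L(X) of all bounded linear operators on X.  The ring
   multiplication defined below is composition and the unit is the identity.
   The structure is a pzRingType, not an nzRingType, because 1 = 0 in L(X)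
   when X = {0}. *)
Record bounded_operator := BoundedOperator {
  bop_fun :> X -> X;
  _ : bop_fun \in bounded_operator_pred }.

HB.instance Definition _ := [isSub for bop_fun].
HB.instance Definition _ := [Choice of bounded_operator by <:].

Lemma bopP (T : bounded_operator) : is_bounded_operator T.
Proof. by case: T => f /= fP; apply/asboolP. Qed.

Lemma bop_ext (S T : bounded_operator) : (forall x, S x = T x) -> S = T.
Proof. by move=> ST; apply/val_inj/funext. Qed.

(* Over a numFieldType the order is only partial, hence the positive real
   bound is stated separately. *)
Lemma is_bounded_operator_gt0 (f : X -> X) : is_bounded_operator f ->
  exists2 M : K, 0 < M & forall x : X, `|f x| <= M * `|x|.
Proof.
case=> _ [M fM]; exists (`|M| + 1) => [|x].
  by rewrite ltr_wpDl.
have Mx : M * `|x| \is Num.real.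
  by rewrite ger0_real// (le_trans _ (fM x)).
rewrite (le_trans (fM x))// (le_trans (real_ler_norm Mx))//.
by rewrite normrM normr_id mulrDl mul1r lerDl.
Qed.

Lemma is_bounded_operator_comp (f g : X -> X) :
  is_bounded_operator f -> is_bounded_operator g ->
  is_bounded_operator (f \o g).
Proof.
move=> fP gP; split=> [a x y /=|]; first by rewrite gP.1 fP.1.
have [M M0 fM] := is_bounded_operator_gt0 fP.
have [N N0 gN] := is_bounded_operator_gt0 gP.
exists (M * N) => x /=; rewrite (le_trans (fM _))// -mulrA.
by rewrite ler_wpM2l// ltW.
Qed.

Lemma is_bounded_operator_id : is_bounded_operator (@id X).
Proof. by split=> //; exists 1 => x; rewrite mul1r. Qed.

Fact bounded_operator_submod_closed : submod_closed bounded_operator_pred.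
Proof.
split=> [|a f g /asboolP fP /asboolP gP]; apply/asboolP.
  split=> [b x y|]; first by rewrite /= scaler0 addr0.
  by exists 0 => x; rewrite /= normr0 mul0r.
split=> [b x y|].
  rewrite !fctE fP.1 gP.1 !scalerDr !scalerA (mulrC a b) -!addrA.
  by congr (_ + _); rewrite addrCA.
have [M M0 fM] := is_bounded_operator_gt0 fP.
have [N N0 gN] := is_bounded_operator_gt0 gP.
exists (`|a| * M + N) => x; rewrite !fctE (le_trans (ler_normD _ _))//.
by rewrite mulrDl lerD// normrZ -mulrA ler_wpM2l.
Qed.

HB.instance Definition _ := GRing.isSubmodClosed.Build K (X -> X)
  bounded_operator_pred bounded_operator_submod_closed.
HB.instance Definition _ :=
  [SubChoice_isSubLmodule of bounded_operator by <:].

Definition bop_comp (S T : bounded_operator) : bounded_operator :=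
  BoundedOperator
    (asboolT (is_bounded_operator_comp (bopP S) (bopP T))).

Definition bop_id : bounded_operator :=
  BoundedOperator (asboolT is_bounded_operator_id).

Lemma bop_addE (S T : bounded_operator) x : (S + T) x = S x + T x.
Proof. by []. Qed.

Fact bop_compA : associative bop_comp.
Proof. by move=> S T U; apply: bop_ext. Qed.

Fact bop_comp1o : left_id bop_id bop_comp.
Proof. by move=> T; apply: bop_ext. Qed.

Fact bop_compo1 : right_id bop_id bop_comp.
Proof. by move=> T; apply: bop_ext. Qed.

Fact bop_compDl : left_distributive bop_comp +%R.
Proof. by move=> S T U; apply: bop_ext. Qed.

Fact bop_compDr : right_distributive bop_comp +%R.
Proof.
move=> S T U; apply: bop_ext => x.
by have := (bopP S).1 1 (T x) (U x); rewrite !scale1r.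
Qed.

HB.instance Definition _ := GRing.Zmodule_isPzRing.Build bounded_operator
  bop_compA bop_comp1o bop_compo1 bop_compDl bop_compDr.

Lemma bop_oppE (T : bounded_operator) x : (- T) x = - T x.
Proof. by []. Qed.

Lemma bop_scaleE (a : K) (T : bounded_operator) x : (a *: T) x = a *: T x.
Proof. by []. Qed.

Lemma bop_mulE (S T : bounded_operator) x : (S * T) x = S (T x).
Proof. by []. Qed.

Lemma bop_oneE x : (1 : bounded_operator) x = x.
Proof. by []. Qed.

Lemma bop_scalerAl (a : K) (S T : bounded_operator) :
  a *: (S * T) = (a *: S) * T.
Proof. by apply: bop_ext. Qed.

Lemma bop_scalerAr (a : K) (S T : bounded_operator) :
  a *: (S * T) = S * (a *: T).
Proof.
apply: bop_ext => x; rewrite bop_mulE !bop_scaleE bop_mulE.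
have S0 : S 0 = 0.
  have := (bopP S).1 (- 1) 0 0.
  by rewrite !scaleN1r oppr0 addr0 addNr.
by have := (bopP S).1 a (T x) 0; rewrite S0 !addr0.
Qed.

End BoundedOperators.

Notation "''L' ( X )" := (bounded_operator X)
  (at level 8, format "''L' ( X )") : type_scope.

(* These notions only involve the ring structure of the algebra. *)
Section GeneralizedDrazin.
Variable A : pzRingType.

Definition invertible (a : A) : Prop := exists b : A, a * b = 1 /\ b * a = 1.

Definition comm (a : A) : set A := [set x | x * a = a * x].

Definition comm2 (a : A) : set A :=
  [set x | forall y, comm a y -> x * y = y * x].

Definition qnil : set A :=
  [set a | forall x, comm a x -> invertible (1 + a * x)].

Definition gDrazin_invertible : set A :=
  [set a | exists b : A,
     [/\ b = b * a * b, comm2 a b & qnil (a - a ^+ 2 * b)]].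

End GeneralizedDrazin.

Definition gDrazin_spectrum (R : realType) (X : completeNormedModType R[i])
    (T : 'L(X)) : set R[i] :=
  [set lambda | ~ gDrazin_invertible (lambda *: (1 : 'L(X)) - T)].

(* Main.v *)
(* Write p = AC and q = DB.  Then U = Bp and V = qD satisfy (BD)U = Up,
   pV = V(BD), VU = p^3 and UV = (BD)^3: the operators AC and BD are shift
   equivalent.  In any ring, shift equivalent x and y (yU = Ux, xV = Vy,
   VU = x^m, UV = y^m) have simultaneously g-Drazin invertible translates
   l - x and l - y when l = 0 or l is a central unit:
   - if b is the g-Drazin inverse of x, then U b^(m+1) V is that of y;
   - if b is the g-Drazin inverse of 1 - x with spectral idempotent e, then x is
     invertible on the range of e, with inverse r say, f = U e r^m V is the
     spectral idempotent of 1 - y, and the inverse of 1 - y off the range of f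
     is 1 + y + ... + y^(m-1) + U b V.
   The case of a central unit l reduces to l = 1 by scaling. *)
Require Import Defs.
From mathcomp Require Import all_boot all_order all_algebra.
From mathcomp Require Import complex.
From mathcomp Require Import boolp classical_sets functions reals normedtype.

Set Implicit Arguments.
Unset Strict Implicit.
Unset Printing Implicit Defensive.

Import GRing.Theory.

Local Open Scope ring_scope.

(** * Double commutants, units of the form [1 - t] and g-Drazin inverses in a ring *)

Section RingLemmas.
Variable T : pzRingType.
Implicit Types (a b c d e f g n t u v w x y : T).

Lemma comm2_comm a g : comm2 a g -> g * a = a * g.
Proof. by apply. Qed.

Lemma comm2_1 a : comm2 a 1.
Proof. by move=> y _; rewrite mul1r mulr1. Qed.

Lemma comm2_self a : comm2 a a.
Proof. by move=> y /= ->. Qed.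

Lemma comm2B a g d : comm2 a g -> comm2 a d -> comm2 a (g - d).
Proof. by move=> ga da y ya; rewrite mulrBl mulrBr ga // da. Qed.

Lemma comm2M a g d : comm2 a g -> comm2 a d -> comm2 a (g * d).
Proof. by move=> ga da y ya; rewrite -mulrA da // !mulrA ga. Qed.

Lemma comm2X a g k : comm2 a g -> comm2 a (g ^+ k).
Proof.
move=> ga; elim: k => [|k IH]; first exact: comm2_1.
by rewrite exprS; apply: comm2M.
Qed.

Lemma comm2_inv a g d : comm2 a g -> g * d = 1 -> d * g = 1 -> comm2 a d.
Proof.
move=> ga gd dg y ya.
by rewrite -[d * y]mulr1 -gd !mulrA -(mulrA d y g) -ga // mulrA dg mul1r.
Qed.

Lemma comm2_1B a g : comm2 (1 - a) g -> comm2 a g.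
Proof.
by move=> ga y /= ya; apply: ga; rewrite /comm /= mulrBr mulrBl mulr1 mul1r ya.
Qed.

Lemma comm2_B1 a g : comm2 a g -> comm2 (1 - a) g.
Proof. by move=> ga; apply: comm2_1B; rewrite subKr. Qed.

(** Jacobson's lemma: if [d] inverts [1 - v * u], then [1 + u * d * v] inverts [1 - u * v]. *)
Lemma jacobson_invertible u v :
  invertible (1 - v * u) -> invertible (1 - u * v).
Proof.
move=> [d [Ed dE]]; exists (1 + u * d * v); split.
- have E : (1 - u * v) * u = u * (1 - v * u).
    by rewrite mulrBl mulrBr mul1r mulr1 mulrA.
  by rewrite mulrDr mulr1 !mulrA E -(mulrA u) Ed mulr1 subrK.
- have E : v * (1 - u * v) = (1 - v * u) * v.
    by rewrite mulrBl mulrBr mul1r mulr1 mulrA.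
  by rewrite mulrDl mul1r -!mulrA E (mulrA d) dE mul1r subrK.
Qed.

(** The geometric sum [S] satisfies [(1 - t) * S = 1 - t ^+ k] and commutes with [1 - t], hence also
    with the inverse [d] of [1 - t ^+ k]; so [S * d] is a two-sided inverse. *)
Lemma invertible_1BX t k : invertible (1 - t ^+ k) -> invertible (1 - t).
Proof.
move=> [d [Ed dE]]; set S := \sum_(i < k) t ^+ i.
have ES : (1 - t) * S = 1 - t ^+ k.
  by rewrite -[RHS]opprB subrX1 -mulNr opprB.
have cS : S * (1 - t) = (1 - t) * S.
  apply: commr_sym; apply: commr_sum => i _; apply: commr_sym.
  by apply: commrB; [apply: commr1 | apply: commr_sym; apply: commrX].
exists (S * d); split; first by rewrite mulrA ES.
have -> : S * d = d * S.
  have cE : (1 - t ^+ k) * S = S * (1 - t ^+ k) by rewrite -ES mulrA cS.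
  by rewrite -[LHS]mul1r -dE -(mulrA d) (mulrA _ S) cE -mulrA Ed mulr1.
by rewrite -mulrA cS ES.
Qed.

Lemma gDrazin_invertibleZ u v a : u * v = 1 -> (forall t, u * t = t * u) ->
  gDrazin_invertible a -> gDrazin_invertible (u * a).
Proof.
move=> uv cu [b [bab ba qa]].
have vu : v * u = 1 by rewrite -cu.
have cv t : v * t = t * v.
  by rewrite -[LHS]mulr1 -uv mulrA -(mulrA v) -cu mulrA vu mul1r.
have cancel_u t w : u * t = u * w -> t = w.
  by move=> E; rewrite -[t]mul1r -vu -mulrA E mulrA vu mul1r.
exists (v * b); split.
- by rewrite {1}bab !mulrA -(mulrA v b u) -cu !mulrA vu mul1r -cv !mulrA.
- move=> y /= ya; rewrite -mulrA ba ?mulrA ?cv //.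
  by apply: cancel_u; rewrite !mulrA (cu y) -mulrA ya.
- have -> : u * a - (u * a) ^+ 2 * (v * b) = u * (a - a ^+ 2 * b).
    rewrite mulrBr !expr2 !mulrA; congr (_ - _ * _).
    by rewrite -(mulrA _ a v) -cv mulrA -(mulrA _ u v) uv mulr1.
  move: (a - a ^+ 2 * b) qa => n qn w /= wn.
  (* The central factor moves onto [w]: [u * n * w = n * (u * w)], and [u * w] commutes with [n]. *)
  rewrite cu -mulrA; apply: qn.
  by rewrite /comm /= (cu w) -mulrA wn (cu n) -!mulrA (cu w).
Qed.

(** Here [f] is the spectral idempotent and [c] inverts [a] on the range of [1 - f]. Such a [c]
    inherits double commutation from [f]: for [y] commuting with [a], [c * y = c * y * a * c = c * a
    * y * c = y * c]. *)
Lemma gDrazin_of_idempotent a c f : comm2 a f -> a * c = 1 - f ->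
  c * a = 1 - f -> c * (1 - f) = c -> (1 - f) * c = c -> qnil (a * f) ->
  gDrazin_invertible a.
Proof.
move=> fa ac ca cf fc qf; exists c; split.
- by rewrite ca fc.
- move=> y ya.
  have fy : (1 - f) * y = y * (1 - f) by rewrite mulrBl mulrBr mul1r mulr1 fa.
  by rewrite -{1}cf -mulrA fy -ac !mulrA -(mulrA c y a) ya mulrA ca fy
    -mulrA fc.
- by rewrite expr2 -mulrA ac mulrBr mulr1 subKr.
Qed.

(** * Shift equivalence of lag [m], as in symbolic dynamics, and transport of commutants *)

Definition shift_equivalent (m : nat) x y U V :=
  [/\ y * U = U * x, x * V = V * y, V * U = x ^+ m & U * V = y ^+ m].

Lemma shift_equivalent_sym m x y U V :
  shift_equivalent m x y U V -> shift_equivalent m y x V U.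
Proof. by case. Qed.

Lemma shift_equivalentZ m x y U V u : (forall t, u * t = t * u) ->
  shift_equivalent m x y U V ->
  shift_equivalent m (u * x) (u * y) (u ^+ m * U) V.
Proof.
move=> cu [yU xV VU UV].
have cum t : u ^+ m * t = t * u ^+ m by apply: commr_sym; apply: commrX.
split.
- by rewrite cum mulrA -(mulrA u) yU -(mulrA _ (u ^+ m)) cum !mulrA cu -!mulrA.
- by rewrite -mulrA xV mulrA cu -mulrA cu.
- by rewrite mulrA -cum -mulrA VU exprMn_comm.
- by rewrite -mulrA UV exprMn_comm.
Qed.

Lemma intertwineX x y U k : y * U = U * x -> y ^+ k * U = U * x ^+ k.
Proof.
move=> yU; elim: k => [|k IH]; first by rewrite !expr0 mul1r mulr1.
by rewrite exprSr -mulrA yU mulrA IH -mulrA -exprSr.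
Qed.

(** If [w] commutes with [y], then [V * w * U] commutes with [x], hence with [g]. The factor
    [x ^+ m] becomes [y ^+ m = U * V] next to [w], which produces [V * w * U]. *)
Lemma shift_comm2 m x y U V g : shift_equivalent m x y U V ->
  comm2 x g -> comm2 y (U * (g * x ^+ m) * V).
Proof.
move=> [yU xV VU UV] gx w /= wy.
have wym : w * y ^+ m = y ^+ m * w by apply: commrX.
have cx : comm x (V * w * U).
  by rewrite /comm /= !mulrA xV -(mulrA V y w) -wy -!mulrA yU.
have xVm : x ^+ m * V = V * y ^+ m by apply: intertwineX.
have yUm : y ^+ m * U = U * x ^+ m by apply: intertwineX.
have gxm : g * x ^+ m = x ^+ m * g by apply: commrX; apply: gx.
transitivity (U * (g * (V * w * U)) * V).
  by rewrite -!mulrA UV wym (mulrA _ V) xVm !mulrA.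
by rewrite gx // gxm !mulrA UV -wym -(mulrA w) yUm !mulrA.
Qed.

(* In the applications [z = y * f], and [w] need not commute with [y] or [f]
   separately. *)
Lemma comm_intertwine n z U V w : V * z = n * V -> z * U = U * n ->
  comm z w -> comm n (V * w * U).
Proof.
move=> Vz zU /= wz.
by rewrite /comm /= -mulrA -zU !mulrA -Vz -(mulrA V w) wz mulrA.
Qed.

(** * Transport of g-Drazin invertibility along a shift equivalence *)

Lemma shift_gDrazin0 m x y U V : shift_equivalent m x y U V ->
  gDrazin_invertible x -> gDrazin_invertible y.
Proof.
move=> sh [b [bab bx qx]]; have [yU xV VU UV] := sh.
have cbx : b * x = x * b by apply: bx.
have [B [cB Bx bxB]] : exists B, [/\ comm2 x B, B * x ^+ m = b & b * x * B = B].
  exists (b ^+ m.+1); split; [exact: comm2X | | by rewrite exprS mulrA -bab].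
  elim: m {sh VU UV} => [|k IH]; first by rewrite expr0 mulr1.
  by rewrite exprS (exprSr x) !mulrA -(mulrA b) IH -mulrA cbx mulrA.
have cBx : B * x = x * B by apply: cB.
have xB : x ^+ m * B = b by rewrite -Bx; apply: commr_sym; apply: commrX.
have xxB : x ^+ m * x * B = x * b by rewrite -exprSr exprS -mulrA xB.
pose e := 1 - x * b; pose c := U * B * V; pose f := 1 - U * (x * B) * V.
have f1 : 1 - f = U * (x * B) * V by rewrite subKr.
have fy : comm2 y f.
  apply: comm2B; first exact: comm2_1.
  (* A factor [x ^+ m] is split off to reach the form required by [shift_comm2]. *)
  have xBE : x * B = x * (B * (x * B)) * x ^+ m.
    rewrite -mulrA -(mulrA B) -(mulrA x) Bx -cbx; congr (_ * _).
    by rewrite -{1}bxB cB // /comm /= {1}cbx -mulrA.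
  rewrite xBE; apply: (shift_comm2 sh).
  by do 3![apply: comm2M => //]; apply: comm2_self.
have yc : y * c = 1 - f by rewrite f1 /c !mulrA yU.
have cy : c * y = 1 - f by rewrite f1 /c -!mulrA -xV (mulrA B) cBx -!mulrA.
have cf : c * (1 - f) = c.
  rewrite f1 /c !mulrA -(mulrA _ V U) VU -(mulrA U B) Bx.
  by rewrite -(mulrA U b) -(mulrA U (b * x)) bxB.
have fc : (1 - f) * c = c.
  rewrite f1 /c !mulrA -(mulrA _ V U) VU -(mulrA (U * x)) Bx -(mulrA U x) -cbx.
  by rewrite -(mulrA U (b * x)) bxB.
have fU : f * U = U * e.
  by rewrite /f /e mulrBl mulrBr mul1r mulr1 -(mulrA _ V) VU -(mulrA U)
    -(mulrA x) Bx.
have Vf : V * f = e * V.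
  by rewrite /f /e mulrBl mulrBr mul1r mulr1 !mulrA VU xxB.
apply: (gDrazin_of_idempotent fy yc cy cf fc).
set z := y * f.
have cfy : f * y = y * f by apply: comm2_comm.
have ff : f * f = f.
  have : y * c * (1 - f) = y * c by rewrite -mulrA cf.
  rewrite yc mulrBr mulr1 -[RHS]subr0 => /addrI /oppr_inj.
  by rewrite mulrBl mul1r => /subr0_eq.
have zz : z * z = y * z by rewrite /z mulrA -(mulrA y f) cfy -!mulrA ff.
have zX k : z ^+ k.+1 = y ^+ k * z.
  elim: k => [|k IH]; first by rewrite expr0 mul1r.
  by rewrite exprSr IH -mulrA zz mulrA -exprSr.
have nE : x - x ^+ 2 * b = x * e by rewrite /e mulrBr mulr1 expr2 mulrA.
rewrite nE in qx.
have Vz : V * z = x * e * V by rewrite /z mulrA -xV -mulrA Vf mulrA.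
have zU : z * U = U * (x * e) by rewrite /z -mulrA fU mulrA yU mulrA.
have zm : z ^+ m.+1 = U * (x * e * V) by rewrite zX -UV -mulrA Vz.
move=> w wz; pose w' := (- w) ^+ m.+1.
have Nwz : comm z (- w) by rewrite /comm /= mulNr mulrN wz.
have w'z : comm z w' by apply: commr_sym; apply: commrX; apply: commr_sym.
(* The power [m.+1] makes [z ^+ m.+1 = U * (x * e * V)] available. Jacobson's lemma then moves [U]
   to the right, leaving [x * e] times an element of its commutant. *)
rewrite -[z * w]opprK -mulrN; apply: (@invertible_1BX _ m.+1).
rewrite exprMn_comm ?zm; last by apply: commr_sym.
rewrite -mulrA; apply: jacobson_invertible.
rewrite -!(mulrA (x * e)) -mulrN; apply: qx; rewrite /comm /= mulNr mulrN.
by rewrite -/w' (comm_intertwine Vz zU w'z).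
Qed.

Lemma shift_gDrazin1 m x y U V : shift_equivalent m x y U V ->
  gDrazin_invertible (1 - x) -> gDrazin_invertible (1 - y).
Proof.
move=> sh; set a := 1 - x => -[b [bab ba qa]]; have [yU xV VU UV] := sh.
pose e := 1 - a * b; pose n := a * e.
have nE : a - a ^+ 2 * b = n by rewrite /n /e mulrBr mulr1 expr2 mulrA.
rewrite nE in qa.
have ca : comm2 a a by apply: comm2_self.
have cba : b * a = a * b by apply: ba.
have ce : comm2 a e by apply: comm2B; [apply: comm2_1 | apply: comm2M].
have cn : comm2 a n by apply: comm2M.
have cx : comm2 a x.
  by rewrite -[x](subKr 1); apply: comm2B => //; apply: comm2_1.
have be : b * e = e * b by apply: ba; apply: comm2_comm.
have ee : e * e = e.
  by rewrite {1}/e mulrBl mul1r {2}/e mulrBr mulr1 -mulrA (mulrA b a b)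
    -bab subrr subr0.
have ab1 : a * b = 1 - e by rewrite subKr.
have en : n * e = n by rewrite /n -mulrA ee.
(* Quasinilpotence of [n] is tested on [-1]. Since [x] acts as [1 - n] on the range of [e], [r]
   inverts [x] there. *)
have [r [nr rn]] : invertible (1 - n).
  by rewrite -[n]mulr1 -mulrN; apply: qa; rewrite /comm /= mulN1r mulrN1.
have cr : comm2 a r.
  by apply: comm2_inv nr rn; apply: comm2B => //; apply: comm2_1.
have xe : x * e = (1 - n) * e.
  by rewrite mulrBl en mul1r -[x](subKr 1) mulrBl mul1r.
have crx : r * x = x * r by apply: cr; apply: cx.
have cre : r * e = e * r by apply: cr; apply: ce.
have rxe k : r ^+ k * x ^+ k * e = e.
  rewrite -exprMn_comm //; elim: k => [|k IH]; first by rewrite mul1r.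
  by rewrite exprSr -mulrA -(mulrA r) xe (mulrA r) rn mul1r.
pose g := e * r ^+ m.
have cg : comm2 a g by apply: comm2M => //; apply: comm2X.
have cgx : comm2 x g by apply: comm2_1B.
have gx : g * x ^+ m = e.
  by rewrite /g -mulrA ce ?rxe //; apply: comm2_comm; apply: comm2M;
    apply: comm2X.
have ge : g * e = g.
  by rewrite cg; [rewrite /g mulrA ee | apply: comm2_comm].
have xg : x ^+ m * g = e.
  by rewrite -gx; apply: commr_sym; apply: commrX; apply: cgx.
have gE : g = e * r ^+ m by [].
clearbody g; pose f := U * g * V.
have fy : comm2 y f.
  (* Again a factor [x ^+ m] is exhibited for [shift_comm2]; it is cancelled by [r ^+ m] on the
     range of [e]. *)
  suff gEx : g = g * r ^+ m * x ^+ m.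
    rewrite /f gEx; apply: (shift_comm2 sh); apply: comm2_1B.
    by apply: comm2M => //; apply: comm2X.
  have cgr : g * r ^+ m = r ^+ m * g.
    by apply: commrX; apply: cg; apply: comm2_comm.
  by rewrite cgr -mulrA gx gE; apply: commrX; apply: commr_sym.
have fU : f * U = U * e by rewrite /f -mulrA VU -mulrA gx.
have Vf : V * f = e * V by rewrite /f !mulrA VU xg.
have fE : f = U * g * V by [].
have cfy : f * y = y * f by apply: comm2_comm.
have ff : f * f = f by rewrite {1}/f -mulrA Vf mulrA -(mulrA U) ge.
clearbody f.
have fNf : f * (1 - f) = 0 by rewrite mulrBr mulr1 ff subrr.
pose S := \sum_(i < m) y ^+ i; pose h := S + U * b * V.
have yS : (1 - y) * S = 1 - y ^+ m by rewrite -[RHS]opprB subrX1 -mulNr opprB.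
have Sc t : t * y = y * t -> t * S = S * t.
  by move=> ty; apply: commr_sum => i _; apply: commrX.
have yU1 : (1 - y) * U = U * a by rewrite mulrBl mulrBr mul1r mulr1 yU.
have Vy1 : V * (1 - y) = a * V by rewrite mulrBl mulrBr mul1r mulr1 xV.
(* The term [U * V] coming from [U * (a * b) * V] cancels the [y ^+ m] left by the geometric sum. *)
have yh : (1 - y) * h = 1 - U * e * V.
  rewrite mulrDr yS !mulrA yU1 -(mulrA U a) ab1 mulrBr mulr1 mulrBl UV.
  by rewrite addrA subrK.
have hy : h * (1 - y) = (1 - y) * h.
  rewrite [LHS]mulrDl [RHS]mulrDr -(Sc (1 - y)); last first.
    by rewrite mulrBl mulrBr mul1r mulr1.
  by rewrite -!(mulrA U) -[b * V * _]mulrA Vy1 (mulrA b) cba !mulrA yU1.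
have fh : f * h = h * f.
  rewrite [LHS]mulrDr [RHS]mulrDl Sc //; congr (_ + _).
  by rewrite !mulrA fU -(mulrA _ V f) Vf mulrA -(mulrA U b) be mulrA.
pose c := h * (1 - f).
have cf : c * (1 - f) = c by rewrite /c -mulrA mulrBl mul1r fNf subr0.
have fc : (1 - f) * c = c.
  have fh1 : (1 - f) * h = c by rewrite mulrBl mul1r fh /c mulrBr mulr1.
  by rewrite {1}/c mulrA fh1 cf.
have y1f : f * (1 - y) = (1 - y) * f by rewrite mulrBl mulrBr mul1r mulr1 cfy.
have yc : (1 - y) * c = 1 - f.
  rewrite /c mulrA yh mulrBl mul1r mulrBr mulr1 -(mulrA _ V) Vf !mulrA.
  by rewrite -(mulrA U e e) ee subrr subr0.
have cy : c * (1 - y) = 1 - f.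
  have fN : (1 - f) * (1 - y) = (1 - y) * (1 - f).
    by rewrite [LHS]mulrBl [RHS]mulrBr mul1r mulr1 y1f.
  by rewrite -yc /c -mulrA fN mulrA hy -mulrA.
apply: (gDrazin_of_idempotent (comm2_B1 fy) yc cy cf fc).
set z := (1 - y) * f.
have Vz : V * z = n * V by rewrite /z mulrA Vy1 -mulrA Vf mulrA.
have zU : z * U = U * n by rewrite /z -mulrA fU mulrA yU1 -mulrA.
move=> w wz.
(* As [f] itself has the form [U * g * V], Jacobson's lemma applies without taking powers. *)
have -> : 1 + z * w = 1 - U * (n * r ^+ m * V * - w).
  rewrite !mulrN opprK /z fE !mulrA yU1; congr (1 + _ * _ * _).
  by rewrite -!mulrA; congr (_ * _); rewrite gE.
apply: jacobson_invertible; rewrite mulrN mulNr opprK -!(mulrA n).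
have cnV := comm_intertwine Vz zU wz.
have crn : r ^+ m * n = n * r ^+ m.
  by apply: (comm2X m cr); apply: comm2_comm.
apply: qa; rewrite /comm /= -!(mulrA (r ^+ m)).
by rewrite cnV mulrA crn -!mulrA.
Qed.

End RingLemmas.

(** * Translates by scalars in the algebra of bounded operators *)

Section ShiftEquivalentOperators.
Variables (R : realType) (X : completeNormedModType R[i]).
Implicit Types (l : R[i]) (t x y U V : 'L(X)).

Local Notation I := (1 : 'L(X)).

Lemma bop_scalarC l t : (l *: I) * t = t * (l *: I).
Proof. by rewrite -bop_scalerAl -bop_scalerAr mul1r mulr1. Qed.

Lemma shift_gDrazin m x y U V l : shift_equivalent m x y U V ->
  gDrazin_invertible (l *: I - x) -> gDrazin_invertible (l *: I - y).
Proof.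
have [->|l0] := eqVneq l 0; rewrite ?scale0r ?sub0r => sh.
  (* For [l = 0] the sign is absorbed by rescaling the shift equivalence by the central element
     [-1]. *)
  rewrite -[- x]mulN1r -[- y]mulN1r; apply: shift_gDrazin0.
  by apply: shift_equivalentZ sh => t; rewrite mulN1r mulrN1.
have lV : (l *: I) * (l^-1 *: I) = 1.
  by rewrite -bop_scalerAl mul1r scalerA divff // scale1r.
have Vl : (l^-1 *: I) * (l *: I) = 1 by rewrite bop_scalarC.
have scale t : l *: I - t = (l *: I) * (1 - (l^-1 *: I) * t).
  by rewrite mulrBr mulr1 mulrA lV mul1r.
have unscale t : 1 - (l^-1 *: I) * t = (l^-1 *: I) * (l *: I - t).
  by rewrite mulrBr Vl.
move/(gDrazin_invertibleZ Vl (bop_scalarC l^-1)); rewrite -unscale => gx.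
rewrite scale; apply: gDrazin_invertibleZ lV (bop_scalarC l) _.
by apply: shift_gDrazin1 gx; apply: shift_equivalentZ (bop_scalarC _) sh.
Qed.

End ShiftEquivalentOperators.

Theorem theorem4p2 (R : realType) (X : completeNormedModType R[i])
    (A B C D : 'L(X))
    (hAC : (A * C) ^+ 2 = (D * B) * (A * C))
    (hDB : (D * B) ^+ 2 = (A * C) * (D * B))
    (hB : B * (A * C) * A = B * (D * B) * A)
    (hC : C * (A * C) * D = C * (D * B) * D) :
  gDrazin_spectrum (B * D) = gDrazin_spectrum (A * C).
Proof.
have sh : shift_equivalent 3 (A * C) (B * D) (B * (A * C)) (D * B * D).
  split.
  - by rewrite -(mulrA B (A * C)) -expr2 hAC !mulrA.
  - by rewrite mulrA -hDB expr2 !mulrA.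
  (* With [p = A * C] and [q = D * B]: [V * U = q ^+ 2 * p = p * q * p = p ^+ 3]. *)
  - by rewrite !mulrA -(mulrA (D * B) D B) -expr2 hDB -!mulrA (mulrA D)
      -hAC !exprS !mulrA mulr1.
  - by rewrite [LHS]mulrA -(mulrA B (A * C)) -hDB expr2 !exprS expr0 mulr1
      !mulrA.
(* Both inclusions follow by contraposition, since shift equivalence is symmetric. *)
by apply/seteqP; split => l /= nl gl; apply: nl; apply: shift_gDrazin gl;
  [exact: sh | exact: shift_equivalent_sym sh].
Qed.
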